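(* Let $s=\{s_1,\dots,s_n\}$ be a sequence of positive integers with associated pair $(\varphi,\epsilon)=\left(n,\tfrac12\sum_{i=1}^n s_i\right)$ such that $s=d(G)$ for some $3$-connected graph $G\in\mathcal{G}_3$. Then $G$ is contained in the entry $p_{\,\epsilon-3\varphi+6,\ \varphi-4}$ of $P_{\mathcal{G}_3}$.
   Context: All graphs are simple (no loops, no parallel edges), undirected and finite; $V_G$ and $E_G$ denote the vertex and edge sets of $G$. A graph $G$ is $3$-connected when there exist at least $3$ internally disjoint paths in $G$ between any two vertices of $G$ (two paths with endpoints $a$ and $b$ are internally disjoint if they share only the vertices $a,b$ and no edges). $\mathcal{G}_3$ is the set of all (unlabelled) $3$-connected simple graphs. The degree sequence $d(G)$ is the monotonic non-increasing sequence of the degrees of the vertices of $G$. The associated pair of $s=\{s_1,\dots,s_n\}$ is $(\varphi(s),\epsilon(s))=\left(n,\tfrac12\sum_{i=1}^n s_i\right)$, abbreviated $(\varphi,\epsilon)$. The partition matrix of $\mathcal{G}_3$ is $P_{\mathcal{G}_3}=(p_{i,j})_{i\in\mathbb{Z},\,j\in\mathbb{N}_0}$, where $p_{i,j}=\{G\in\mathcal{G}_3 \mid |V_G|=j+4 \text{ and } |E_G|=i+3j+6\}$ ($i$ indexes rows and $j$ indexes columns). *)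

(* Defs.v *)
From mathcomp Require Import all_boot all_order all_algebra.

Set Implicit Arguments.
Unset Strict Implicit.
Unset Printing Implicit Defensive.

Import GRing.Theory Num.Theory.
Local Open Scope ring_scope.

(* The null graph is excluded: it would be vacuously 3-connected below. *)
Record graph := Graph {
  vertex :> finType;
  adj : rel vertex;
  adj_sym : symmetric adj;
  adj_irrefl : irreflexive adj;
  vertex_gt0 : (0 < #|vertex|)%N
}.

Definition edges (G : graph) : {set {set G}} :=
  [set [set x; y] | x in G, y in G & adj x y].

Definition degree (G : graph) (x : G) : nat := #|[set y | adj x y]|.

Definition degree_sequence (G : graph) : seq nat :=
  sort geq [seq degree x | x <- enum G].

Definition isomorphic (G H : graph) : Prop :=
  exists2 f : G -> H, bijective f & forall x y, adj (f x) (f y) = adj x y.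

(* An unlabelled graph is an isomorphism class, given by its membership
   predicate. *)
Definition ugraph := graph -> Prop.

Definition unlabelled (G : graph) : ugraph := fun H => isomorphic G H.

(* A path from a to b is encoded by the list p of its vertices after a. *)
Definition is_path (G : graph) (a b : G) (p : seq G) : bool :=
  [&& path (@adj G) a p, last a p == b & uniq (a :: p)].

Definition path_edges (G : graph) (a : G) (p : seq G) : seq {set G} :=
  pairmap (fun x y => [set x; y]) a p.

Definition internally_disjoint (G : graph) (a b : G) (p q : seq G) : bool :=
  [forall x, (x \in a :: p) && (x \in a :: q) ==> (x == a) || (x == b)]
  && [forall e, ~~ ((e \in path_edges a p) && (e \in path_edges a q))].

(* A path between distinct vertices has an edge, so it is not internally
   disjoint from itself and the list ps below has no repetition. *)
Definition three_connected (G : graph) : Prop :=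
  forall a b : G, a != b ->
    exists ps : seq (seq G),
      [/\ (3 <= size ps)%N, all (is_path a b) ps
        & pairwise (internally_disjoint a b) ps].

Definition G3 (U : ugraph) : Prop :=
  exists2 G, U = unlabelled G & three_connected G.

Definition partition_matrix_G3 (i : int) (j : nat) (U : ugraph) : Prop :=
  exists G, [/\ U = unlabelled G, three_connected G, #|G| = (j + 4)%N
              & #|edges G|%:Z = i + 3 * j%:Z + 6].

Definition associated_pair (s : seq nat) : nat * rat :=
  (size s, (\sum_(k <- s) k)%N%:R / 2).

(* Main.v *)
(* The handshake lemma turns the degree sum into twice the number of edges, so
   the row index is #|E_G| - 3 (#|V_G| - 4) - 6.  The column index is a natural
   number because G has at least four vertices: positive degrees provide an
   edge ab, and three edge-disjoint paths from a to b leave a through three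
   different neighbours. *)
Require Import Defs.
From mathcomp Require Import all_boot all_order all_algebra.
From mathcomp Require Import ring.

Import GRing.Theory Num.Theory.
Local Open Scope ring_scope.

Lemma isomorphic_refl (G : graph) : isomorphic G G.
Proof. by exists id => //; exists id. Qed.

Lemma isomorphic_card {G H : graph} : isomorphic G H -> #|G| = #|H|.
Proof. by case=> f bij_f _; apply: bij_eq_card bij_f. Qed.

Lemma degree_isomorphism {G H : graph} {f : G -> H} (x : G) :
  bijective f -> (forall x y, adj (f x) (f y) = adj x y) ->
  degree (f x) = degree x.
Proof.
move=> bij_f adj_f; have [g fK gK] := bij_f.
rewrite /degree -(card_imset _ (can_inj fK)); apply: eq_card => y.
by rewrite (can2_imset_pre _ fK gK) !inE -(adj_f x) gK.
Qed.

Lemma isomorphic_sum_degree {G H : graph} :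
  isomorphic G H -> (\sum_(x : G) degree x = \sum_(y : H) degree y)%N.
Proof.
case=> f bij_f adj_f; rewrite [RHS](reindex f) /=; last exact: onW_bij.
by apply: eq_bigr => x _; rewrite (degree_isomorphism x bij_f).
Qed.

Lemma card_edge {G : graph} {e : {set G}} : e \in edges G -> #|e| = 2%N.
Proof.
case/imset2P=> x y _; rewrite inE => /andP[_ xy] ->.
by rewrite cards2; case: eqVneq xy => // ->; rewrite adj_irrefl.
Qed.

Lemma set2_injr {T : finType} (x : T) : injective (fun y => [set x; y]).
Proof.
move=> y z /= /setP eq_yz.
have := eq_yz y; have := eq_yz z; rewrite !inE !eqxx !orbT.
by case: (eqVneq z x) => [->|_ /=]; [case: (eqVneq y x) | move/eqP].
Qed.

(** The map sending [y] to [[set x; y]] is injective and carries the neighbours of [x] onto the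
    edges at [x]. *)
Lemma degree_incident_edges (G : graph) (x : G) :
  degree x = #|[set e in edges G | x \in e]|.
Proof.
rewrite /degree -(card_imset _ (set2_injr x)); apply: eq_card => e.
rewrite inE; apply/imsetP/andP => [[y] | [/imset2P[y z _]]].
  rewrite inE => xy ->; rewrite set21; split=> //.
  by apply/imset2P; exists x y; rewrite ?inE.
rewrite inE => /andP[_ yz] -> /set2P[] ->; first by exists z; rewrite ?inE.
by exists y; rewrite ?inE 1?adj_sym // setUC.
Qed.

(** Double counting of the pairs of a vertex and an edge containing it: swapping the sums leaves the
    two ends of each edge. *)
Lemma handshake (G : graph) : (\sum_(x : G) degree x = #|edges G| * 2)%N.
Proof.
rewrite (eq_bigr (fun x => \sum_(e in edges G) (x \in e))%N); last first.
  move=> x _; rewrite degree_incident_edges -sum1_card big_mkcond [RHS]big_mkcond.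
  by apply: eq_bigr => e _; rewrite inE; case: (e \in _); case: (x \in e).
rewrite exchange_big -sum_nat_const; apply: eq_bigr => e /card_edge <-.
by rewrite -sum1_card [RHS]big_mkcond; apply: eq_bigr => x _; case: (x \in e).
Qed.

Lemma path_headP {G : graph} {a b : G} {p : seq G} :
  a != b -> is_path a b p ->
  exists x, x != a /\ [set a; x] \in path_edges a p.
Proof.
case: p => [|x p] /= ne_ab; first by case/and3P=> _ /=; rewrite (negPf ne_ab).
case/and3P=> _ _ /= /andP[]; rewrite inE negb_or => /andP[ne_ax _] _.
by exists x; rewrite eq_sym /path_edges /= mem_head.
Qed.

Lemma three_connected_card {G : graph} {a b : G} :
  three_connected G -> a != b -> (4 <= #|G|)%N.
Proof.
move=> conG ne_ab; have [[|p [|q [|r ps]]] [//= _]] := conG a b ne_ab.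
case/and4P=> /(path_headP ne_ab)[x [xa ep]] /(path_headP ne_ab)[y [ya eq]].
case/(path_headP ne_ab)=> z [za er] _ /and3P[/and3P[pq pr _] /andP[qr _] _].
(* The edge clause of disjointness is used because the vertex clause would allow both paths to start
   with a step to [b]. *)
have heads_neq p1 p2 u v : internally_disjoint a b p1 p2 ->
    [set a; u] \in path_edges a p1 -> [set a; v] \in path_edges a p2 -> u != v.
  case/andP=> _ /forallP/(_ [set a; u]) + e1 e2; rewrite e1 /=.
  by apply: contra => /eqP ->.
have xy := heads_neq _ _ _ _ pq ep eq; have xz := heads_neq _ _ _ _ pr ep er.
have yz := heads_neq _ _ _ _ qr eq er.
have /card_uniqP/= card4 : uniq [:: x; y; z; a].
  by rewrite /= !inE !negb_or xy xz yz xa ya za.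
by rewrite -card4 max_card.
Qed.

Lemma size_degree_sequence (G : graph) : size (degree_sequence G) = #|G|.
Proof. by rewrite size_sort size_map -cardE. Qed.

Lemma sum_degree_sequence (G : graph) :
  (\sum_(k <- degree_sequence G) k = \sum_(x : G) degree x)%N.
Proof.
by rewrite (perm_big _ (permEl (perm_sort _ _))) big_map big_enum.
Qed.

Theorem lemma6p2 (s : seq nat) (phi : nat) (eps : rat) (G : graph) :
  all (fun k => 0 < k)%N s ->
  associated_pair s = (phi, eps) ->
  G3 (unlabelled G) ->
  s = degree_sequence G ->
  exists (i : int) (j : nat),
    [/\ i%:~R = eps - 3 * phi%:R + 6,
        j%:Z = phi%:Z - 4
      & partition_matrix_G3 i j (unlabelled G)].
Proof.
move=> s_gt0 [<- <-] [H GH conH] def_s.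
(* Equal classes have equal members, and [G] lies in its own class. *)
have isoHG : isomorphic H G.
  by rewrite -/(unlabelled H G) -GH; apply: isomorphic_refl.
have cardHG := isomorphic_card isoHG.
have sumHG := isomorphic_sum_degree isoHG.
have cardG : (4 <= #|G|)%N.
  have /card_gt0P[x _] := vertex_gt0 G.
  have : (0 < degree x)%N.
    apply: (allP s_gt0); rewrite def_s mem_sort.
    by apply: map_f; rewrite mem_enum.
  case/card_gt0P=> y; rewrite inE => xy.
  have ne_xy : x != y by apply: contraTneq xy => ->; rewrite adj_irrefl.
  (* Three-connectivity is known for [H] only, so the adjacent vertices [x] and [y] are pulled back
     along the isomorphism. *)
  have [f [g fK gK] _] := isoHG; rewrite -cardHG.
  by apply: (three_connected_card (a := g x) (b := g y)) => //; rewrite (can_eq gK).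
rewrite def_s size_degree_sequence sum_degree_sequence -sumHG handshake.
(* By the handshake lemma [eps] is the number of edges, so the row index is an integer; [cardG]
   keeps the subtraction in the column index from truncating. *)
exists (#|edges H|%:Z - 3 * #|G|%:Z + 6), (#|G| - 4)%N; split.
- rewrite natrM mulfK // rmorphD rmorphB /= rmorphM /=.
  by rewrite -!pmulrn.
- by rewrite subzn.
- exists H; split=> //; first by rewrite cardHG subnK.
  (* With e edges and n vertices: (e - 3n + 6) + 3(n - 4) + 6 = e. *)
  by rewrite -subzn //; ring.
Qed.
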